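(* Let $\Delta,\nu$ be integers with $\Delta,\nu\ge2$, and let $G\in E_3(\Delta,\nu)$ be a graph with no isolated vertices. Then $G$ is the unique element of $E_3(\Delta,\nu)$ up to isomorphism if and only if $\lceil\Delta(G)/2\rceil$ divides $\nu(G)$.
   Context: All graphs are finite and simple and, throughout, have no isolated vertices. $\Delta(G)$ is the maximum degree, $\nu(G)$ the size of a maximum matching. For positive integers $\Delta,\nu$, $e_3(\Delta,\nu)=\max\{|E(G)|:\Delta(G)\le\Delta,\ \nu(G)\le\nu\}$, the maximum over graphs without isolated vertices, and $E_3(\Delta,\nu)$ is the set of graphs $G$ without isolated vertices with $\Delta(G)\le\Delta$, $\nu(G)\le\nu$ and $|E(G)|=e_3(\Delta,\nu)$.
   Formalization: The divisibility condition uses the parameter Δ, i.e. ⌈Δ/2⌉ divides ν(G), instead of ⌈Δ(G)/2⌉; as written the claim fails for Δ=5, ν=2, G=K_5 (2K_{1,5} is also extremal, yet ⌈4/2⌉=2 divides 2). *)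

(* Defs.v *)
From mathcomp Require Import all_boot.

Set Implicit Arguments.
Unset Strict Implicit.
Unset Printing Implicit Defensive.

Record sgraph := SGraph {
  vertex :> finType;
  adj : rel vertex;
  adj_sym : symmetric adj;
  adj_irrefl : irreflexive adj
}.

Definition edges (G : sgraph) : {set {set G}} :=
  [set e | [exists x : G, exists y : G, adj x y && (e == [set x; y])]].

Definition degree (G : sgraph) (x : G) : nat := #|[set y | adj x y]|.

Definition max_degree (G : sgraph) : nat := \max_(x : G) degree x.

Definition matching (G : sgraph) (M : {set {set G}}) : bool :=
  (M \subset edges G) && trivIset M.

Definition matching_number (G : sgraph) : nat :=
  \max_(M : {set {set G}} | matching M) #|M|.

Definition no_isolated (G : sgraph) : Prop :=
  forall x : G, exists y : G, adj x y.

Definition isomorphic (G H : sgraph) : Prop :=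
  exists2 f : G -> H, bijective f & forall x y, adj (f x) (f y) = adj x y.

Definition admissible (D n : nat) (G : sgraph) : Prop :=
  [/\ no_isolated G, max_degree G <= D & matching_number G <= n].

(* [is_e3 D n m] states m = e_3(D, n). The maximum is given as a relation
   because it ranges over graphs on arbitrary finite vertex types. *)
Definition is_e3 (D n m : nat) : Prop :=
  (exists2 G : sgraph, admissible D n G & #|edges G| = m) /\
  (forall G : sgraph, admissible D n G -> #|edges G| <= m).

Definition E3 (D n : nat) (G : sgraph) : Prop :=
  admissible D n G /\ is_e3 D n #|edges G|.

(* Main.v *)
Require Import Defs.
From mathcomp Require Import all_boot zify.

Set Implicit Arguments.
Unset Strict Implicit.
Unset Printing Implicit Defensive.

(* Write c = uphalf D and f = D./2.  By the Tutte-Berge formula there are a set S and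
   a partition of its complement such that every edge avoiding S lies in one block and
   |S| plus the sum of the k_C = |C|./2 is at most nu.  Edges meeting S number at most
   D |S|, and a block C spans at most k_C D edges, plus f if k_C >= c, so there are at
   most nu D + f (nu %/ c) edges (Chvatal-Hanson), and this is attained.  If c divides
   nu, equality forces S to be empty and all blocks to have 2c + 1 vertices and c D + f
   edges: they are complete graphs for D even, and for D odd the complement of a block
   is a path with two edges plus a perfect matching on the other vertices.  If c does
   not divide nu, with remainder r, then nu %/ c blocks plus r stars is extremal, and so
   is a graph with fewer vertices: replace two stars by K_(2,D) if r >= 2, and merge the
   star with a block if r = 1. *)

(** * The Tutte-Berge formula *)

Lemma sum_cardI_trivIset (T : finType) (P : {set {set T}}) (A : {set T}) :
  trivIset P -> \sum_(C in P) #|C :&: A| = #|cover P :&: A|.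
Proof.
move=> tP; rewrite -sum1_card.
rewrite (eq_bigl (fun x => (x \in cover P) && (x \in A))); last by move=> x; rewrite inE.
rewrite big_trivIset_cond //; apply: eq_bigr => C _.
by rewrite -sum1_card; apply: eq_bigl => x; rewrite inE.
Qed.

Section Basics.
Variable G : sgraph.
Implicit Types (x y u v t : G) (e : {set G}) (M N : {set {set G}}).

Lemma adj_neq x y : adj x y -> x != y.
Proof. by apply: contraTneq => ->; rewrite adj_irrefl. Qed.

Lemma edge_in x y : adj x y -> [set x; y] \in edges G.
Proof.
by move=> xy; rewrite inE; apply/existsP; exists x; apply/existsP; exists y; rewrite xy eqxx.
Qed.

Lemma edgeP e x : e \in edges G -> x \in e -> exists2 y, adj x y & e = [set x; y].
Proof.
rewrite inE => /existsP[u /existsP[v /andP[uv /eqP->]]].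
rewrite !inE => /orP[]/eqP->; first by exists v.
by exists u; rewrite 1?adj_sym 1?setUC.
Qed.

Lemma card_edge e : e \in edges G -> #|e| = 2.
Proof.
rewrite inE => /existsP[u /existsP[v /andP[uv /eqP->]]].
by rewrite cards2 (adj_neq uv).
Qed.

Lemma set2_inj x : injective (fun y => [set x; y]).
Proof.
move=> y z /setP E; have := E y; have := E z; rewrite !inE !eqxx !orbT.
by case: (eqVneq z x) => [->|_ /eqP//] _; rewrite orbb => /esym/eqP.
Qed.

Lemma handshake : \sum_(x : G) degree x = 2 * #|edges G|.
Proof.
rewrite mulnC -sum_nat_const.
transitivity (\sum_(e in edges G) \sum_(x in e) 1); last first.
  by apply: eq_bigr => e /card_edge <-; rewrite sum1_card.
rewrite (exchange_big_dep predT) //=; apply: eq_bigr => x _.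
(* The edges at [x] are the images of its neighbours under the injection sending [y] to
   [[set x; y]]. *)
rewrite sum1_card /degree -(card_imset _ (@set2_inj x)).
apply: eq_card => e; apply/imsetP/andP.
  by case=> y yA ->; rewrite inE in yA; rewrite edge_in // set21.
by case=> eE /(edgeP eE)[y xy ->]; exists y; rewrite ?inE.
Qed.

Lemma matching_edge M e : matching M -> e \in M -> e \in edges G.
Proof. by case/andP=> /subsetP sM _ /sM. Qed.

Lemma card_cover_matching M : matching M -> #|cover M| = 2 * #|M|.
Proof.
move=> mM; have /andP[_ /eqP <-] := mM.
rewrite mulnC -sum_nat_const; apply: eq_bigr => e eM.
exact: card_edge (matching_edge mM eM).
Qed.

Lemma matching_subset M N : N \subset M -> matching M -> matching N.
Proof.
move=> sNM /andP[sM tM]; rewrite /matching (subset_trans sNM sM).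
exact: trivIsetS tM.
Qed.

Lemma matching_add M x y : matching M -> adj x y ->
  x \notin cover M -> y \notin cover M ->
  matching ([set x; y] |: M) /\ [set x; y] \notin M.
Proof.
move=> mM xy xM yM; have /andP[sM tM] := mM.
have M0 : set0 \notin M.
  by apply/negP => /(matching_edge mM)/card_edge; rewrite cards0.
have dis : {in M, forall f : {set G}, [disjoint [set x; y] & f]}.
  move=> f fM; rewrite -setI_eq0; apply/eqP/setP => z; rewrite !inE.
  apply/negbTE/negP => /andP[zxy zf].
  have zM : z \in cover M by apply/bigcupP; exists f.
  by case/orP: zxy => /eqP E; move: zM; rewrite E ?(negbTE xM) ?(negbTE yM).
have [tM' nM] := trivIsetU1 dis tM M0; split=> //.
by rewrite /matching tM' andbT subUset sub1set edge_in.
Qed.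

Lemma cover_add M e : cover (e |: M) = e :|: cover M.
Proof. by rewrite /cover bigcup_setU big_set1. Qed.

Lemma coverS M N : N \subset M -> cover N \subset cover M.
Proof.
by move=> /subsetP s; apply/bigcupsP => e /s eM; apply: bigcup_sup eM.
Qed.

Section Gallai.
Variable W : {set G}.

(** The induction below deletes vertices; confining matchings to a set [W] keeps the vertex type
    fixed. *)
Definition matching_in M := matching M && (cover M \subset W).

Definition maximum_in M :=
  matching_in M && [forall N, matching_in N ==> (#|N| <= #|M|)].

Lemma maximum_inP M : reflect
  (matching_in M /\ forall N, matching_in N -> #|N| <= #|M|) (maximum_in M).
Proof.
apply: (iffP andP) => -[mM H]; split=> //.
  by move=> N; apply/implyP/(forallP H).
by apply/forallP => N; apply/implyP/H.
Qed.

Lemma maximum_in_exists : exists M, maximum_in M.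
Proof.
have m0 : matching_in set0.
  by rewrite /matching_in /matching /trivIset /cover !big_set0 cards0 !sub0set eqxx.
have [M mM H] := @arg_maxnP _ set0 matching_in (fun M => #|M|) m0.
by exists M; apply/maximum_inP.
Qed.

Lemma maximum_in_card M N : maximum_in M -> maximum_in N -> #|M| = #|N|.
Proof.
by move=> /maximum_inP[mM HM] /maximum_inP[mN HN]; apply/eqP; rewrite eqn_leq HN ?HM.
Qed.

Lemma maximum_in_adj M x y : maximum_in M -> x \in W -> y \in W -> adj x y ->
  x \notin cover M -> y \in cover M.
Proof.
move=> /maximum_inP[/andP[mM sM] H] xW yW xy xM; apply/negPn/negP => yM.
have [mM' nM] := matching_add mM xy xM yM.
suff /H : matching_in ([set x; y] |: M) by rewrite cardsU1 nM ltnn.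
by rewrite /matching_in mM' cover_add !subUset !sub1set xW yW.
Qed.

(* Among the maximum matchings N missing t take one sharing most edges with M; N
   covers u and v, so some x <> t is covered by M only, and exchanging the edge of
   M at x with the edge of N at the other endpoint increases the overlap. *)
Lemma maximum_in_missing_trans M u v t : maximum_in M -> u != v ->
    u \notin cover M -> v \notin cover M ->
    (exists2 N, maximum_in N & t \notin cover N) ->
  exists2 N, maximum_in N & (t \notin cover N) && ((u \notin cover N) || (v \notin cover N)).
Proof.
move=> xM uv uM vM [N0 xN0 tN0]; pose P N := maximum_in N && (t \notin cover N).
have PN0 : P N0 by rewrite /P xN0.
have [N /andP[xN tN] HN] := @arg_maxnP _ N0 P (fun N => #|M :&: N|) PN0.
exists N; rewrite // tN /= -negb_and; apply/negP => /andP[uN vN].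
have /maximum_inP[/andP[mM sM] _] := xM; have /maximum_inP[/andP[mN sN] HmN] := xN.
have cMN : #|cover M| = #|cover N|.
  by rewrite !card_cover_matching // (maximum_in_card xM xN).
have [x /setDP[xcM xcN] xt] : exists2 x, x \in cover M :\: cover N & x != t.
  have : #|cover N :\: cover M| = #|cover M :\: cover N|.
    by rewrite !cardsD setIC cMN.
  have : #|[set u; v]| <= #|cover N :\: cover M|.
    by apply: subset_leq_card; rewrite subUset !sub1set !inE uM vM uN vN.
  rewrite cards2 uv => le2 E; move: le2; rewrite E => le2.
  have : 0 < #|(cover M :\: cover N) :\ t|.
    by have := cardsD1 t (cover M :\: cover N); case: (t \in _) => /=; move: le2; clear; lia.
  by case/card_gt0P => x; rewrite !in_setD1 => /andP[? ?]; exists x.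
have [e eM xe] := bigcupP xcM.
have [y xy Ee] := edgeP (matching_edge mM eM) xe.
have ye : y \in e by rewrite Ee !inE eqxx orbT.
have ycM : y \in cover M by apply/bigcupP; exists e.
have yN : y \in cover N.
  by apply: maximum_in_adj xy _ => //; apply: (subsetP sM).
have [f fN yf] := bigcupP yN.
have fM : f \notin M.
  apply/negP => fM; case/andP: mM => _ tM.
  have E : f = e by rewrite -(def_pblock tM fM yf) (def_pblock tM eM ye).
  by case/negP: xcN; apply/bigcupP; exists f; rewrite // E.
have sN' : cover (N :\ f) \subset cover N by apply/coverS/subD1set.
have xN' : x \notin cover (N :\ f) by apply: contra xcN; apply: (subsetP sN').
have yN' : y \notin cover (N :\ f).
  apply/negP => /bigcupP[g /setD1P[gf gN] yg]; case/andP: mN => _ tN'.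
  by case/eqP: gf; rewrite -(def_pblock tN' fN yf) (def_pblock tN' gN yg).
have [mN' eN'] := matching_add (matching_subset (subD1set N f) mN) xy xN' yN'.
rewrite -Ee in mN' eN'.
have cN' : #|e |: N :\ f| = #|N| by rewrite cardsU1 eN' [RHS](cardsD1 f) fN.
have : P (e |: N :\ f).
  apply/andP; split.
    apply/maximum_inP; rewrite cN'; split=> //.
    rewrite /matching_in mN' cover_add subUset (subset_trans sN' sN) andbT.
    by rewrite (subset_trans _ sM) //; apply: bigcup_sup.
  have tN' : t \notin cover (N :\ f) by apply: contra tN; apply: (subsetP sN').
  rewrite cover_add Ee in_setU in_set2 !negb_or tN' andbT eq_sym xt /=.
  by apply: contraNneq tN => ->.
move/HN; have eMN : e \notin M :&: N.
  by rewrite inE eM; apply: contra xcN => eN; apply/bigcupP; exists e.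
apply/negP; rewrite -ltnNge.
have -> : #|M :&: N|.+1 = #|e |: (M :&: N)| by rewrite cardsU1 eMN.
apply: subset_leq_card; rewrite subUset sub1set !inE eM eqxx /=.
apply/subsetP => g /setIP[gM gN]; rewrite !inE gM gN andbT /=.
by apply/orP; right; apply: contraNneq fM => <-.
Qed.

End Gallai.

(** Induction on the size of [W]. A vertex covered by every maximum matching is moved into [S]. If
    there is none, then by Gallai's argument being jointly missed by no maximum matching is an
    equivalence relation; its classes are the blocks and [S] is empty. *)
Lemma tutte_berge_in (W : {set G}) : exists (S : {set G}) (P : {set {set G}}) M,
  [/\ S \subset W, partition P (W :\: S), matching_in W M,
      forall x y, x \in W :\: S -> y \in W :\: S -> adj x y -> y \in pblock P x
    & #|S| + \sum_(C in P) #|C|./2 <= #|M|].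
Proof.
move: {2}#|W|.+1 (ltnSn #|W|) => k; elim: k W => // k IH W leWk.
have [M0 xM0] := maximum_in_exists W.
have [/existsP[v /andP[vW /forallP Hv]]|] :=
  boolP [exists v, (v \in W) && [forall M, maximum_in W M ==> (v \in cover M)]].
  have [|S [P [M [sS pP mM HP le]]]] := IH (W :\ v).
    by have := cardsD1 v W; rewrite vW; move: leWk; clear; lia.
  have vS : v \notin S by apply/negP => /(subsetP sS); rewrite !inE eqxx.
  have E : W :\: (v |: S) = (W :\ v) :\: S by rewrite setDDl.
  exists (v |: S), P, M0; rewrite E; split=> //.
  - by rewrite subUset sub1set vW (subset_trans sS) // subD1set.
  - by case/maximum_inP: xM0.
  have /andP[mM1 sM] := mM.
  have mMW : matching_in W M by rewrite /matching_in mM1 (subset_trans sM) // subD1set.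
  have /maximum_inP[mM0 HM0] := xM0.
  (* A maximum matching of [W] would cover [v], which [M] avoids; the edge gained by [M0] pays for
     adding [v] to [S]. *)
  have : #|M| < #|M0|.
    rewrite ltn_neqAle HM0 // andbT; apply/negP => /eqP eqM.
    have /(implyP (Hv M)) vM : maximum_in W M by apply/maximum_inP; rewrite eqM.
    by have := subsetP sM _ vM; rewrite !inE eqxx.
  by rewrite cardsU1 vS; move: le; clear; lia.
rewrite negb_exists => /forallP H.
have iness t : t \in W -> exists2 N, maximum_in W N & t \notin cover N.
  move=> tW; have := H t; rewrite tW /= negb_forall => /existsP[N].
  by rewrite negb_imply => /andP[? ?]; exists N.
(* The disjunct [x == y] makes [r] reflexive: every vertex of [W] is now missed by some maximum
   matching. *)
pose r x y := (x == y) ||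
  ~~ [exists M, [&& maximum_in W M, x \notin cover M & y \notin cover M]].
have rNP x y : reflect (x != y /\ exists2 M, maximum_in W M &
    (x \notin cover M) && (y \notin cover M)) (~~ r x y).
  rewrite /r negb_or negbK; apply: (iffP andP) => -[xy].
    by move=> /existsP[M /andP[? ?]]; split=> //; exists M.
  by move=> [M ? ?]; split=> //; apply/existsP; exists M; apply/andP.
have rsym x y : r x y = r y x.
  rewrite /r eq_sym; congr (_ || ~~ _); apply: eq_existsb => M; by rewrite [X in _ && X]andbC.
(* If a maximum matching misses both [x] and [z], the exchange lemma yields one missing [y] together
   with [x] or [z], against [r x y] or [r y z]. *)
have rtrans x y z : y \in W -> r x y -> r y z -> r x z.
  move=> yW xy yz; apply/negPn/negP => /rNP[xz [M xM /andP[nx nz]]].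
  have [N xN /andP[ny /orP[nx'|nz']]] := maximum_in_missing_trans xM xz nx nz (iness y yW).
    case: (eqVneq x y) => [E|nxy]; last by case/rNP: xy; split=> //; exists N => //; apply/andP.
    by subst y; case/rNP: yz; split=> //; exists M; rewrite ?nx ?nz.
  case: (eqVneq y z) => [E|nyz]; last by case/rNP: yz; split=> //; exists N => //; apply/andP.
  by subst y; case/rNP: xy; split=> //; exists M; rewrite ?nx ?nz.
have eqr : {in W & &, equivalence_rel r}.
  move=> x y z xW yW zW; split=> [|xy]; first by rewrite /r eqxx.
  by apply/idP/idP; apply: rtrans; rewrite // rsym.
pose P := equivalence_partition r W.
have pP : partition P W by apply: equivalence_partitionP.
have HP : {in W &, forall x y, (y \in pblock P x) = r x y}.
  by move=> x y; apply: pblock_equivalence_partition.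
have radj x y : x \in W -> y \in W -> adj x y -> r x y.
  move=> xW yW xy; apply/negPn/negP => /rNP[_ [M xM /andP[nx]]].
  by rewrite (maximum_in_adj xM xW yW xy nx).
exists set0, P, M0; rewrite setD0 sub0set cards0 add0n.
have /maximum_inP[mM0 _] := xM0; split=> //.
  by move=> x y xW yW xy; rewrite HP // radj.
have /andP[mM sM] := mM0; have /and3P[/eqP covP tP _] := pP.
pose MC (C : {set G}) := [set e in M0 | e \subset C].
(* Adjacent vertices are related by [r], so each edge of [M0] lies inside a single class. *)
have coverMC C : C \in P -> C :&: cover M0 = cover (MC C).
  move=> CP; apply/setP => x; rewrite inE; apply/andP/bigcupP.
    case=> xC /bigcupP[e eM xe]; exists e => //; rewrite inE eM /=.
    have [y xy Ee] := edgeP (matching_edge mM eM) xe.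
    have xW : x \in W by rewrite -covP; apply/bigcupP; exists C.
    have yW : y \in W.
      apply: (subsetP sM); apply/bigcupP; exists e => //; by rewrite Ee !inE eqxx orbT.
    rewrite Ee subUset !sub1set xC /= -(def_pblock tP CP xC) HP //; exact: radj.
  case=> e; rewrite inE => /andP[eM eC] xe; split; first exact: (subsetP eC).
  by apply/bigcupP; exists e.
(* Two vertices of one class are never missed together, so [M0] contains [#|C|./2] edges inside each
   class [C]. *)
have miss C : C \in P -> #|C :\: cover M0| <= 1.
  move=> CP; rewrite leqNgt; apply/negP => /card_gt1P[x [y [xC yC nxy]]].
  move: xC yC; rewrite !inE => /andP[nx xC] /andP[ny yC].
  have inW z : z \in C -> z \in W by move=> zC; rewrite -covP; apply/bigcupP; exists C.
  have : r x y by rewrite -HP ?inW // (def_pblock tP CP xC).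
  by apply/negP/rNP; split=> //; exists M0; rewrite ?nx.
have cMC C : #|cover (MC C)| = 2 * #|MC C|.
  by apply: card_cover_matching; apply: matching_subset mM; apply/subsetP => e; rewrite inE => /andP[].
apply: (@leq_trans (\sum_(C in P) #|MC C|)).
  apply: leq_sum => C CP; have := cardsID (cover M0) C.
  by rewrite coverMC // cMC; have := miss C CP; clear; lia.
rewrite -(@leq_pmul2l 2) // -card_cover_matching // big_distrr /=.
have -> : \sum_(C in P) 2 * #|MC C| = #|W :&: cover M0|.
  rewrite (eq_bigr (fun C => #|C :&: cover M0|)); last by move=> C CP; rewrite coverMC ?cMC.
  by rewrite sum_cardI_trivIset // covP.
by apply: subset_leq_card; apply: subsetIr.
Qed.

Lemma matching_number_max M : matching M -> #|M| <= matching_number G.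
Proof. by move=> mM; rewrite /matching_number; apply: leq_bigmax_cond. Qed.

Lemma tutte_berge : exists (S : {set G}) (P : {set {set G}}),
  [/\ partition P (~: S),
      forall x y, x \notin S -> y \notin S -> adj x y -> y \in pblock P x
    & #|S| + \sum_(C in P) #|C|./2 <= matching_number G].
Proof.
have [S [P [M [_ pP /andP[mM _] HP le]]]] := tutte_berge_in [set: G].
rewrite setTD in pP HP; exists S, P; split=> //.
  by move=> x y xS yS; apply: HP; rewrite inE.
exact: leq_trans le (matching_number_max mM).
Qed.

End Basics.

(** * The Chvatal-Hanson bound *)

Definition degree_in (G : sgraph) (C : {set G}) (x : G) := #|[set y in C | adj x y]|.

(** Twice the number of edges spanned by [C]; the doubled form avoids division in the counting. *)
Definition degree_sum_in (G : sgraph) (C : {set G}) := \sum_(x in C) degree_in C x.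

Section UpperBound.
Variables (D : nat) (G : sgraph).
Hypothesis leD : max_degree G <= D.
Implicit Types (x y : G) (C S : {set G}) (P : {set {set G}}).

Definition induced_adj C x y := [&& adj x y, x \in C & y \in C].

Lemma induced_adj_sym C : symmetric (induced_adj C).
Proof. by move=> x y; rewrite /induced_adj adj_sym [(x \in C) && _]andbC. Qed.

Lemma induced_adj_irrefl C : irreflexive (induced_adj C).
Proof. by move=> x; rewrite /induced_adj adj_irrefl. Qed.

Definition induced C := SGraph (induced_adj_sym C) (induced_adj_irrefl C).

(** Handshake in the graph induced on [C], which keeps the whole vertex type and leaves the vertices
    outside [C] isolated. *)
Lemma degree_sum_in_even C : ~~ odd (degree_sum_in C).
Proof.
suff -> : degree_sum_in C = 2 * #|edges (induced C)| by rewrite oddM.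
rewrite -handshake (bigID (mem C)) /= [X in _ + X]big1 ?addn0.
  apply: eq_bigr => x xC; apply: eq_card => y.
  by rewrite !inE /= /induced_adj xC andbC.
move=> x xC; apply/eqP; rewrite cards_eq0; apply/eqP/setP => y.
by rewrite !inE /= /induced_adj (negbTE xC) andbF.
Qed.

Lemma degree_le x : degree x <= D.
Proof. by apply: leq_trans leD; rewrite /max_degree; apply: leq_bigmax. Qed.

Lemma degree_in_le C x : degree_in C x <= D.
Proof.
apply: leq_trans (degree_le x); apply: subset_leq_card.
by apply/subsetP => y; rewrite !inE => /andP[].
Qed.

Lemma degree_in_lt C x : x \in C -> degree_in C x < #|C|.
Proof.
move=> xC; rewrite [#|C|](cardsD1 x) xC; apply: subset_leq_card.
apply/subsetP => y; rewrite !inE => /andP[-> xy]; rewrite andbT.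
by apply: contraTneq xy => ->; rewrite adj_irrefl.
Qed.

Lemma degree_sum_in_le C : degree_sum_in C <= #|C| * D.
Proof. by rewrite -sum_nat_const; apply: leq_sum => x _; apply: degree_in_le. Qed.

(** Let k be [#|C|./2]. If [C] has 2k vertices, their degrees sum to at most 2kD. If it has 2k + 1
    and k is below [uphalf D], then 2k + 1 is at most D and all degrees are at most 2k. Otherwise
    the sum is at most 2kD + D, and parity lowers the last term to [2 * D./2] when D is odd. *)
Lemma degree_sum_in_bound C :
  degree_sum_in C <= 2 * (#|C|./2 * D + (uphalf D <= #|C|./2) * D./2).
Proof.
have ev := degree_sum_in_even C; have le1 := degree_sum_in_le C.
have le2 : degree_sum_in C <= #|C| * #|C|.-1.
  rewrite -sum_nat_const; apply: leq_sum => x /degree_in_lt; clear; lia.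
move: ev le1 le2; move: (degree_sum_in C) #|C| => s m; clear.
have := odd_double_half D; have := odd_double_half m; rewrite uphalf_half.
move: (odd D) (D./2) (odd m) (m./2) => a h b k Em ED ev le1 le2.
have [lek|ltk] /= := leqP (a + h) k; subst; nia.
Qed.

(** In the degree sum, an edge between [S] and its complement is counted once from each end. The
    vertices of [S] account for at most [#|S| * D], and the crossing edges seen from outside for at
    most as much again; everything else stays in blocks. *)
Lemma edges_le_partition S P : partition P (~: S) ->
    (forall x y, x \notin S -> y \notin S -> adj x y -> y \in pblock P x) ->
  2 * #|edges G| <= 2 * (#|S| * D) + \sum_(C in P) degree_sum_in C.
Proof.
move=> pP HP; have /and3P[/eqP covP tP _] := pP.
rewrite -handshake (bigID (mem S)) /=.
have leS : \sum_(x in S) degree x <= #|S| * D.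
  by rewrite -sum_nat_const; apply: leq_sum => x _; apply: degree_le.
have -> : \sum_(C in P) degree_sum_in C = \sum_(x | x \notin S) degree_in (pblock P x) x.
  rewrite (eq_bigl (fun x => x \in cover P)); last by move=> x; rewrite covP inE.
  rewrite big_trivIset //; apply: eq_bigr => C CP; apply: eq_bigr => x xC.
  by rewrite (def_pblock tP CP xC).
have : \sum_(x | x \notin S) degree x <=
    \sum_(x | x \notin S) (degree_in (pblock P x) x + #|[set y in S | adj x y]|).
  apply: leq_sum => x xS; apply: leq_trans (leq_card_setU _ _); apply: subset_leq_card.
  apply/subsetP => y; rewrite !inE => xy; rewrite xy !andbT.
  by case: (boolP (y \in S)) => yS; rewrite ?orbT ?orbF ?HP.
rewrite big_split /= => le1.
have le2 : \sum_(x | x \notin S) #|[set y in S | adj x y]| <= \sum_(y in S) degree y.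
  rewrite (eq_bigr (fun x => \sum_(y in S | adj x y) 1)); last first.
    by move=> x _; rewrite sum1_card; apply: eq_card => y; rewrite !inE.
  rewrite (exchange_big_dep (mem S)) /=; last by move=> x y _ /andP[].
  apply: leq_sum => y yS; rewrite sum1_card; apply: subset_leq_card.
  by apply/subsetP => x; rewrite !inE => /and3P[_ _]; rewrite adj_sym.
move: le1 le2 leS; clear; lia.
Qed.

End UpperBound.

Definition e3_value D n := n * D + D./2 * (n %/ uphalf D).

(** Only blocks with [uphalf D <= #|C|./2] earn the bonus [D./2]. Each uses at least [uphalf D] of
    the total n available, so there are at most [n %/ uphalf D] of them. *)
Lemma edges_le_e3_value D n G : 2 <= D -> admissible D n G -> #|edges G| <= e3_value D n.
Proof.
move=> hD [_ leD len]; have [S [P [pP HP leP]]] := tutte_berge G.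
have := edges_le_partition leD pP HP.
have : \sum_(C in P) degree_sum_in C <=
       \sum_(C in P) 2 * (#|C|./2 * D + (uphalf D <= #|C|./2) * D./2).
  by apply: leq_sum => C _; apply: degree_sum_in_bound.
rewrite -big_distrr /= big_split /= -!big_distrl /=.
have leb : uphalf D * (\sum_(C in P) (uphalf D <= #|C|./2)) <= \sum_(C in P) #|C|./2.
  by rewrite big_distrr /=; apply: leq_sum => C _; case: (leqP (uphalf D) #|C|./2) => h; rewrite ?muln1 ?muln0.
have c0 : 0 < uphalf D by move: hD; clear; lia.
have : \sum_(C in P) (uphalf D <= #|C|./2) <= n %/ uphalf D.
  rewrite leq_divRL // mulnC; apply: leq_trans leb _.
  by apply: leq_trans len; apply: leq_trans leP; apply: leq_addl.
move: leP len; rewrite /e3_value; clear.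
move: #|S| (\sum_(C in P) #|C|./2) (\sum_(C in P) degree_sum_in C)
  (\sum_(C in P) (uphalf D <= #|C|./2)) (matching_number G) #|edges G| (n %/ uphalf D) (D./2).
move=> s k d b nu e q f h1 h2 h3 h4 h5; nia.
Qed.

(** * The case of equality *)

Lemma leq_sum_eq (I : finType) (P : pred I) (E F : I -> nat) :
    (forall i, P i -> E i <= F i) -> \sum_(i | P i) F i <= \sum_(i | P i) E i ->
  forall i, P i -> E i = F i.
Proof.
move=> leEF le i Pi; move: le; rewrite !(bigD1 i Pi) /=.
have : \sum_(j | P j && (j != i)) E j <= \sum_(j | P j && (j != i)) F j.
  by apply: leq_sum => j /andP[/leEF].
have := leEF i Pi; clear; lia.
Qed.

(** Every inequality in the proof of the upper bound becomes tight, first for the totals and then,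
    by [leq_sum_eq], for each block separately. *)
Lemma extremal_partition D q G : 2 <= D -> admissible D (q * uphalf D) G ->
    #|edges G| = e3_value D (q * uphalf D) ->
  exists P : {set {set G}}, [/\ partition P [set: G], #|P| = q,
    forall x y, adj x y -> y \in pblock P x
  & forall C, C \in P -> #|C| = (uphalf D).*2.+1 /\
      degree_sum_in C = 2 * (uphalf D * D + D./2)].
Proof.
move=> hD [iso leD len] eqE; have [S [P [pP HP leP]]] := tutte_berge G.
have le1 := edges_le_partition leD pP HP.
have bnd C : C \in P -> _ := fun _ => degree_sum_in_bound leD C.
have le2 := leq_sum (index_enum _) bnd.
have bnd3 C : C \in P -> uphalf D * (uphalf D <= #|C|./2) <= #|C|./2.
  by move=> _; case: (leqP (uphalf D) #|C|./2) => h; rewrite ?muln1 ?muln0.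
have le3 := leq_sum (index_enum _) bnd3.
have c0 : 0 < uphalf D by move: hD; clear; lia.
have f0 : 0 < D./2 by move: hD; clear; lia.
have [s0 Eq Ek Ed] : [/\ #|S| = 0, \sum_(C in P) (uphalf D <= #|C|./2) = q,
    \sum_(C in P) #|C|./2 <= \sum_(C in P) uphalf D * (uphalf D <= #|C|./2)
  & \sum_(C in P) 2 * (#|C|./2 * D + (uphalf D <= #|C|./2) * D./2) <=
    \sum_(C in P) degree_sum_in C].
  move: le1 le2 le3 eqE leP len; rewrite /e3_value mulnK //.
  rewrite -!big_distrr /= big_split /= -!big_distrl /=.
  move: #|S| (\sum_(C in P) #|C|./2) (\sum_(C in P) degree_sum_in C)
    (matching_number G) #|edges G| (\sum_(C in P) (uphalf D <= #|C|./2)).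
  move: (uphalf D) (D./2) c0 f0 => c f c0 f0 s k d nu e b le1 le2 le3 eqE leP len.
  (* The edge bounds give q c D + f q <= (s + k) D + b f, hence f q <= f b by this estimate;
     conversely c b <= k <= q c. So b = q, which then fixes s and k. *)
  have leD1 : (s + k) * D <= q * c * D by rewrite leq_mul2r; apply/orP; right; lia.
  have lebq : q <= b by rewrite -(leq_pmul2l f0); nia.
  have leqb : b <= q by rewrite -(leq_pmul2l c0); lia.
  have {leqb lebq} E : b = q by lia.
  have Es : s = 0 by subst; lia.
  have Ek : k = q * c by subst; lia.
  by subst; split=> //; lia.
have {s0} S0 : S = set0 by apply/eqP; rewrite -cards_eq0 s0.
rewrite S0 setC0 in pP; have /and3P[/eqP covP tP P0] := pP.
have HP' x y : adj x y -> y \in pblock P x by apply: HP; rewrite S0 inE.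
have termk := leq_sum_eq bnd3 Ek; have termd := leq_sum_eq bnd Ed.
(* By tightness a smaller block has [#|C|./2 = 0], hence a single vertex; but that vertex has a
   neighbour, which lies in the same block. *)
have big C : C \in P -> uphalf D <= #|C|./2.
  move=> CP; rewrite leqNgt; apply/negP => lt.
  have := termk C CP; rewrite leqNgt lt muln0 => C1.
  have [x xC] : exists x, x \in C.
    by apply/set0Pn; apply: contraNneq P0 => <-.
  have [y xy] := iso x.
  have yC : y \in C by rewrite -(def_pblock tP CP xC) HP'.
  have : 1 < #|C| by apply/card_gt1P; exists x, y; split=> //; apply: adj_neq.
  by move: C1; clear; lia.
exists P; split=> // [|C CP].
  by rewrite -[RHS]Eq -sum1_card; apply: eq_bigr => C /big ->.
have := termk C CP; have := termd C CP; rewrite big // mul1n muln1 => Ed1 Ek1.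
rewrite -Ek1 in Ed1; split=> //.
(* There remain the sizes 2c and 2c + 1, and 2c vertices of degree at most D cannot reach the degree
   sum 2(cD + f), as f is positive. *)
have := degree_sum_in_le leD C; rewrite Ed1; move: Ek1 f0.
move: #|C| (uphalf D) (D./2) => m c f; clear => -> f0 le.
rewrite -[LHS]odd_double_half; case: (boolP (odd m)) => // /negbTE om.
have := odd_double_half m; rewrite om; nia.
Qed.

(** * Isomorphism of extremal graphs *)

Lemma uniq_map_inj_in (T U : eqType) (h : T -> U) (s : seq T) :
  uniq (map h s) -> {in s &, injective h}.
Proof.
elim: s => // a s IH /= /andP[ns us] x y; rewrite !inE.
case/orP=> [/eqP->|xs] /orP[/eqP->|ys] // E; last exact: IH.
  by case/negP: ns; rewrite E map_f.
by case/negP: ns; rewrite -E map_f.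
Qed.

(* The bijection between A and B is given by its graph, listed without repetition;
   this makes sense on empty vertex types, and gluing is concatenation. *)
Definition set_iso (G H : sgraph) (A : {set G}) (B : {set H}) : Prop :=
  exists z : seq (G * H), [/\ uniq (unzip1 z), uniq (unzip2 z),
    unzip1 z =i A, unzip2 z =i B & {in z &, forall p q, adj p.1 q.1 = adj p.2 q.2}].

Lemma isomorphic_of_set_iso (G H : sgraph) :
  set_iso [set: G] [set: H] -> isomorphic G H.
Proof.
case=> z [u1 u2 m1 m2 E].
have exz x : exists y, (x, y) \in z.
  have : x \in unzip1 z by rewrite m1 inE.
  by case/mapP=> -[x' y] xyz /= ->; exists y.
pose f x := xchoose (exz x); have fz x : (x, f x) \in z := xchooseP (exz x).
exists f; last by move=> x y; rewrite -(E _ _ (fz x) (fz y)).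
apply: inj_card_bij.
  by move=> x y fxy; have [] := uniq_map_inj_in u2 (fz x) (fz y) fxy.
have <- : size z = #|H|.
  rewrite -(size_map snd) -(card_uniqP u2).
  by apply: eq_card => y; rewrite m2 !inE.
rewrite -(size_map fst) -(card_uniqP u1); exact: max_card.
Qed.

Section SetIso.
Variables G H : sgraph.
Implicit Types (A : {set G}) (B : {set H}).

(** Here [k] is [false] for a disjoint union and [true] for a join; adjacency across the parts is
    constant, so any two partial isomorphisms may be concatenated. *)
Lemma set_isoU k A1 A2 B1 B2 : [disjoint A1 & A2] -> [disjoint B1 & B2] ->
    (forall x y, x \in A1 -> y \in A2 -> adj x y = k) ->
    (forall x y, x \in B1 -> y \in B2 -> adj x y = k) ->
  set_iso A1 B1 -> set_iso A2 B2 -> set_iso (A1 :|: A2) (B1 :|: B2).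
Proof.
move=> dA dB kA kB [z1 [u1 v1 a1 b1 E1]] [z2 [u2 v2 a2 b2 E2]].
exists (z1 ++ z2); split.
- rewrite /unzip1 map_cat cat_uniq u1 u2 andbT /=; apply/hasPn => x xz.
  by rewrite a2 in xz; rewrite /= [x \in _]a1 (disjointFl dA xz).
- rewrite /unzip2 map_cat cat_uniq v1 v2 andbT /=; apply/hasPn => x xz.
  by rewrite b2 in xz; rewrite /= [x \in _]b1 (disjointFl dB xz).
- by move=> x; rewrite /unzip1 map_cat mem_cat a1 a2 inE.
- by move=> x; rewrite /unzip2 map_cat mem_cat b1 b2 inE.
move=> p q; rewrite !mem_cat => pz qz.
have inA1 r : r \in z1 -> r.1 \in A1 by move=> ?; rewrite -a1 map_f.
have inA2 r : r \in z2 -> r.1 \in A2 by move=> ?; rewrite -a2 map_f.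
have inB1 r : r \in z1 -> r.2 \in B1 by move=> ?; rewrite -b1 map_f.
have inB2 r : r \in z2 -> r.2 \in B2 by move=> ?; rewrite -b2 map_f.
case/orP: pz => pz; case/orP: qz => qz; [exact: E1 | | |exact: E2].
  by rewrite kA ?kB ?inA1 ?inA2 ?inB1 ?inB2.
by rewrite adj_sym [RHS]adj_sym kA ?kB ?inA1 ?inA2 ?inB1 ?inB2.
Qed.

Lemma set_iso_independent A B : #|A| = #|B| ->
    (forall x y, x \in A -> y \in A -> adj x y = false) ->
    (forall x y, x \in B -> y \in B -> adj x y = false) ->
  set_iso A B.
Proof.
move=> cAB iA iB; exists (zip (enum A) (enum B)).
have e1 : unzip1 (zip (enum A) (enum B)) = enum A by rewrite unzip1_zip // -!cardE cAB.
have e2 : unzip2 (zip (enum A) (enum B)) = enum B by rewrite unzip2_zip // -!cardE cAB.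
split; rewrite ?e1 ?e2 ?enum_uniq //; try by move=> x; rewrite mem_enum.
move=> p q pz qz.
have inA r : r \in zip (enum A) (enum B) -> r.1 \in A.
  by move=> rz; rewrite -mem_enum -e1 map_f.
have inB r : r \in zip (enum A) (enum B) -> r.2 \in B.
  by move=> rz; rewrite -mem_enum -e2 map_f.
by rewrite iA ?iB ?inA ?inB.
Qed.

(** Any block of [P] matches any block of [Q], so blocks are paired arbitrarily and glued one at a
    time. *)
Lemma set_iso_cover k (P : {set {set G}}) (Q : {set {set H}}) :
    trivIset P -> trivIset Q -> #|P| = #|Q| ->
    (forall A1 A2, A1 \in P -> A2 \in P -> A1 != A2 ->
      forall x y, x \in A1 -> y \in A2 -> adj x y = k) ->
    (forall B1 B2, B1 \in Q -> B2 \in Q -> B1 != B2 ->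
      forall x y, x \in B1 -> y \in B2 -> adj x y = k) ->
    (forall A B, A \in P -> B \in Q -> set_iso A B) ->
  set_iso (cover P) (cover Q).
Proof.
move: {2}#|P| (erefl #|P|) => n; elim: n P Q => [|n IH] P Q.
  move=> /eqP; rewrite cards_eq0 => /eqP-> _ _ /esym/eqP.
  rewrite cards0 cards_eq0 => /eqP-> _ _ _; exists [::].
  by split=> // x; rewrite /cover big_set0 inE.
move=> cP tP tQ cPQ kP kQ iPQ.
have /card_gt0P[A AP] : 0 < #|P| by rewrite cP.
have /card_gt0P[B BQ] : 0 < #|Q| by rewrite -cPQ cP.
have -> : cover P = A :|: cover (P :\ A) by rewrite -cover_add setD1K.
have -> : cover Q = B :|: cover (Q :\ B) by rewrite -cover_add setD1K.
apply: (@set_isoU k); last first.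
- apply: IH; rewrite ?trivIsetD //.
  + by have := cardsD1 A P; rewrite AP cP => -[].
  + by have := cardsD1 A P; have := cardsD1 B Q; rewrite AP BQ cPQ => -> [].
  + by move=> A1 A2 /setD1P[_ ?] /setD1P[_ ?]; apply: kP.
  + by move=> A1 A2 /setD1P[_ ?] /setD1P[_ ?]; apply: kQ.
  + by move=> A1 A2 /setD1P[_ ?] /setD1P[_ ?]; apply: iPQ.
- exact: iPQ.
- move=> x y xB /bigcupP[B2 /setD1P[nB B2Q] yB2].
  by apply: (kQ B B2); rewrite // eq_sym.
- move=> x y xA /bigcupP[A2 /setD1P[nA A2P] yA2].
  by apply: (kP A A2); rewrite // eq_sym.
- rewrite coverD1 // -setI_eq0; apply/eqP/setP => x; rewrite !inE.
  by case: (x \in B); rewrite ?andbF.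
rewrite coverD1 // -setI_eq0; apply/eqP/setP => x; rewrite !inE.
by case: (x \in A); rewrite ?andbF.
Qed.

End SetIso.

(** * Graphs with sparse complement and the extremal blocks *)

Definition nonadj_in (G : sgraph) (A : {set G}) (x : G) := [set y in A | ~~ adj x y].

Lemma card_nonadj_in (G : sgraph) (A : {set G}) (x : G) :
  degree_in A x + #|nonadj_in A x| = #|A|.
Proof.
rewrite -(cardsID [set y | adj x y] A); congr (_ + _).
  by apply: eq_card => y; rewrite !inE.
by apply: eq_card => y; rewrite !inE andbC.
Qed.

(** Since [nonadj_in A x] contains [x], at most one other vertex of [A] is nonadjacent to [x]. Hence
    nonadjacency is transitive, and [A] is complete multipartite with classes of size [m]. *)
Lemma nonadj_in_partition (G : sgraph) (A : {set G}) m : m <= 2 ->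
    (forall x, x \in A -> #|nonadj_in A x| = m) ->
  exists P : {set {set G}}, [/\ partition P A,
    forall C, C \in P -> #|C| = m,
    forall C x y, C \in P -> x \in C -> y \in C -> adj x y = false
  & forall C1 C2, C1 \in P -> C2 \in P -> C1 != C2 ->
      forall x y, x \in C1 -> y \in C2 -> adj x y = true].
Proof.
move=> m2 cA; pose r (x y : G) := ~~ adj x y.
have trans x y z : x \in A -> y \in A -> z \in A -> r x y -> r y z -> r x z.
  move=> xA yA zA; rewrite /r adj_sym => xy yz; apply/negP => xz.
  have nxz := adj_neq xz.
  have nyx : y != x by apply: contraNneq yz => ->.
  have nyz : y != z by apply: contraNneq xy => ->; rewrite adj_sym.
  have : #|y |: [set x; z]| <= #|nonadj_in A y|.
    apply: subset_leq_card; rewrite !subUset !sub1set !inE.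
    by rewrite yA xA zA adj_irrefl xy yz.
  by rewrite cA // cardsU1 cards2 nxz !inE negb_or nyx nyz; move: m2; clear; lia.
have eqr : {in A & &, equivalence_rel r}.
  move=> x y z xA yA zA; split=> [|xy]; first by rewrite /r adj_irrefl.
  by apply/idP/idP; apply: trans => //; rewrite /r adj_sym.
have pP := equivalence_partitionP eqr; have HP := pblock_equivalence_partition eqr.
set P := equivalence_partition r A in pP HP *.
have /and3P[/eqP covP tP P0] := pP.
have inA C x : C \in P -> x \in C -> x \in A.
  by move=> CP xC; rewrite -covP; apply/bigcupP; exists C.
have EC C x y : C \in P -> x \in C -> y \in A -> (y \in C) = ~~ adj x y.
  by move=> CP xC yA; rewrite -(def_pblock tP CP xC) HP // (inA C).
exists P; split=> //.
- move=> C CP; have [x xC] : exists x, x \in C.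
    by apply/set0Pn; apply: contraNneq P0 => <-.
  rewrite -(cA x (inA C x CP xC)); apply: eq_card => y; rewrite inE.
  apply/idP/andP => [yC|[yA xy]]; last by rewrite (EC C x).
  by have yA := inA C y CP yC; rewrite -(EC C x y CP xC yA).
- by move=> C x y CP xC yC; apply/negbTE; rewrite -(EC C x) // (inA C).
move=> C1 C2 P1 P2 n12 x y x1 y2; apply/negPn; rewrite -(EC C1 x) ?(inA C2) //.
by apply: contra n12 => y1; rewrite -(def_pblock tP P1 y1) (def_pblock tP P2 y2).
Qed.

(** Both sides are complete multipartite with equally many classes of size [m]: a complete graph for
    [m = 1], the complement of a perfect matching for [m = 2]. *)
Lemma set_iso_uniform (G H : sgraph) (A : {set G}) (B : {set H}) m : 0 < m <= 2 ->
    (forall x, x \in A -> #|nonadj_in A x| = m) ->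
    (forall x, x \in B -> #|nonadj_in B x| = m) ->
  #|A| = #|B| -> set_iso A B.
Proof.
case/andP=> m0 m2 cA cB cAB.
have [P [pP sP iP kP]] := nonadj_in_partition m2 cA.
have [Q [pQ sQ iQ kQ]] := nonadj_in_partition m2 cB.
have cPQ : #|P| = #|Q|.
  apply/eqP; rewrite -(eqn_pmul2r m0).
  by rewrite -(card_uniform_partition sP pP) -(card_uniform_partition sQ pQ) cAB.
have /and3P[/eqP <- tP _] := pP; have /and3P[/eqP <- tQ _] := pQ.
apply: (@set_iso_cover _ _ true) => // C1 C2 C1P C2Q.
apply: set_iso_independent; first by rewrite sP ?sQ.
  by move=> x y; apply: iP.
by move=> x y; apply: iQ.
Qed.

(* The complement of the graph induced on C is a path with two edges centred at w
   together with a perfect matching of the remaining vertices. *)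
Lemma nonadj_in_centre (G : sgraph) (C : {set G}) w : w \in C ->
    #|nonadj_in C w| = 3 -> (forall x, x \in C -> x != w -> #|nonadj_in C x| = 2) ->
  let W := nonadj_in C w in
  [/\ w \in W, W \subset C, forall x y, x \in [set w] -> y \in W :\ w -> adj x y = false,
      forall x y, x \in W -> y \in C :\: W -> adj x y = true &
      (forall x, x \in W :\ w -> #|nonadj_in (W :\ w) x| = 1) /\
      (forall x, x \in C :\: W -> #|nonadj_in (C :\: W) x| = 2)].
Proof.
move=> wC c3 c2 W.
have wW : w \in W by rewrite !inE wC adj_irrefl.
have sW : W \subset C by apply/subsetP => x; rewrite !inE => /andP[].
(* The vertex [x] is nonadjacent to itself and to [w], which exhausts its two nonadjacencies. *)
have NW x : x \in W -> x != w -> nonadj_in C x = [set x; w].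
  move=> xW xw; have xC := subsetP sW x xW.
  apply/esym/eqP; rewrite eqEcard cards2 xw c2 // leqnn andbT.
  rewrite subUset !sub1set !inE xC wC adj_irrefl /=.
  by move: xW; rewrite !inE adj_sym => /andP[].
have cross x y : x \in W -> y \in C :\: W -> adj x y = true.
  move=> xW /setDP[yC yW]; have [E|nxw] := eqVneq x w.
    by move: yW; rewrite !inE yC E negbK.
  apply/negPn/negP => nxy; have : y \in nonadj_in C x by rewrite inE yC.
  rewrite NW // !inE => /orP[]/eqP E; first by rewrite E xW in yW.
  by rewrite E wW in yW.
split=> //.
  by move=> x y /set1P->; rewrite !inE => /and3P[_ _ /negbTE].
split=> x.
  case/setD1P=> xw xW; rewrite -(cards1 x); apply: eq_card => y; rewrite !in_set1.
  apply/idP/eqP => [|->]; last by rewrite inE in_setD1 xw xW adj_irrefl.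
  rewrite inE in_setD1 => /andP[/andP[yw yW] nxy].
  have : y \in nonadj_in C x by rewrite inE (subsetP sW).
  by rewrite NW // !inE (negbTE yw) orbF => /eqP.
move=> xCW; have /setDP[xC xW] := xCW.
have xw : x != w by apply: contraNneq xW => ->.
rewrite -(c2 x xC xw); apply: eq_card => y; rewrite [in LHS]inE [in RHS]inE in_setD.
case yC : (y \in C); rewrite ?andbF ?andbT //=.
case yW : (y \in W) => //=; by rewrite adj_sym cross.
Qed.

(** Each side is the join of two pieces: an isolated centre plus an edge, and the complement of a
    perfect matching. *)
Lemma set_iso_centre (G H : sgraph) (A : {set G}) (B : {set H}) u v :
    u \in A -> v \in B -> #|A| = #|B| ->
    #|nonadj_in A u| = 3 -> (forall x, x \in A -> x != u -> #|nonadj_in A x| = 2) ->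
    #|nonadj_in B v| = 3 -> (forall x, x \in B -> x != v -> #|nonadj_in B x| = 2) ->
  set_iso A B.
Proof.
move=> uA vB cAB u3 u2 v3 v2.
have [uW sW i1 x1 [n1 m1]] := nonadj_in_centre uA u3 u2.
have [vV sV i2 x2 [n2 m2]] := nonadj_in_centre vB v3 v2.
move: (nonadj_in A u) (nonadj_in B v) => W V in u3 v3 uW sW i1 x1 n1 m1 vV sV i2 x2 n2 m2 *.
have disD (T : finType) (X Y : {set T}) : [disjoint X & Y :\: X].
  by rewrite -setI_eq0; apply/eqP/setP => x; rewrite !inE; case: (x \in X); rewrite ?andbF.
have -> : A = W :|: (A :\: W) by rewrite setDE setUIr setUCr setIT; apply/esym/setUidPr.
have -> : B = V :|: (B :\: V) by rewrite setDE setUIr setUCr setIT; apply/esym/setUidPr.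
apply: (@set_isoU _ _ true) => //; last first.
  apply: (@set_iso_uniform _ _ _ _ 2) => //.
  by rewrite !cardsD (setIidPr sW) (setIidPr sV) cAB u3 v3.
rewrite -(setD1K uW) -(setD1K vV); apply: (@set_isoU _ _ false) => //.
  apply: set_iso_independent; first by rewrite !cards1.
    by move=> x y /set1P-> /set1P->; apply: adj_irrefl.
  by move=> x y /set1P-> /set1P->; apply: adj_irrefl.
apply: (@set_iso_uniform _ _ _ _ 1) => //.
have := cardsD1 u W; have := cardsD1 v V; rewrite uW vV u3 v3; clear; lia.
Qed.

(** The deficiencies [D - degree_in C x] sum to (2c + 1)D - 2(cD + f) = D - 2f, that is, to [odd D].
    So for even D all degrees equal D, and for odd D exactly one vertex falls short, by one. *)
Lemma extremal_block D (G : sgraph) (C : {set G}) : max_degree G <= D ->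
    #|C| = (uphalf D).*2.+1 -> degree_sum_in C = 2 * (uphalf D * D + D./2) ->
  if odd D then exists w, [/\ w \in C, #|nonadj_in C w| = 3 &
                     forall x, x \in C -> x != w -> #|nonadj_in C x| = 2]
  else forall x, x \in C -> #|nonadj_in C x| = 1.
Proof.
move=> leD cC sC.
have ED := odd_double_half D; have Ec := uphalf_half D.
have Es : \sum_(x in C) (D - degree_in C x) + degree_sum_in C = #|C| * D.
  rewrite -big_split /= -sum_nat_const; apply: eq_bigr => x _.
  by rewrite subnK // degree_in_le.
have {}Es : \sum_(x in C) (D - degree_in C x) = odd D.
  by move: Es; rewrite sC cC; move: (\sum_(x in C) _) (uphalf D) (D./2) (odd D) ED Ec; clear; nia.
have dN x : D - degree_in C x = 0 -> #|nonadj_in C x| = (odd D).+1.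
  move=> E; have := degree_in_le leD C x; have := card_nonadj_in C x.
  by move: E cC ED Ec; case: (odd D); clear; lia.
case: ifP Es dN => oD Es dN; last first.
  move=> x xC; apply: dN; apply/eqP.
  by move/eqP: Es; rewrite sum_nat_eq0 => /forallP/(_ x); rewrite xC.
have [w wC dw] : exists2 w, w \in C & D - degree_in C w != 0.
  apply/exists_inP; apply: contraPT (introT eqP Es) => /exists_inPn h.
  by rewrite big1 // => x /h /negPn/eqP.
move: Es; rewrite (bigD1 w wC) /= => Es.
have dw1 : D - degree_in C w = 1 by move: Es dw; clear; lia.
exists w; split=> // [|x xC xw].
  have := degree_in_le leD C w; have := card_nonadj_in C w.
  by move: dw1 cC ED Ec; rewrite oD; clear; lia.
have xCw : (x \in C) && (x != w) by rewrite xC.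
by apply: dN; move: Es; rewrite (bigD1 x xCw) /=; move: dw1; clear; lia.
Qed.

Lemma extremal_isomorphic D q G H : 2 <= D ->
    admissible D (q * uphalf D) G -> #|edges G| = e3_value D (q * uphalf D) ->
    admissible D (q * uphalf D) H -> #|edges H| = e3_value D (q * uphalf D) ->
  isomorphic G H.
Proof.
move=> hD aG eG aH eH; apply: isomorphic_of_set_iso.
have [P [pP cP aP bP]] := extremal_partition hD aG eG.
have [Q [pQ cQ aQ bQ]] := extremal_partition hD aH eH.
have /and3P[/eqP <- tP _] := pP; have /and3P[/eqP <- tQ _] := pQ.
apply: (@set_iso_cover _ _ false) => //; first by rewrite cP cQ.
- move=> C1 C2 P1 P2 n12 x y x1 y2; apply/negP => /aP.
  rewrite (def_pblock tP P1 x1) => y1; case/eqP: n12.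
  by rewrite -(def_pblock tP P1 y1) (def_pblock tP P2 y2).
- move=> C1 C2 P1 P2 n12 x y x1 y2; apply/negP => /aQ.
  rewrite (def_pblock tQ P1 x1) => y1; case/eqP: n12.
  by rewrite -(def_pblock tQ P1 y1) (def_pblock tQ P2 y2).
move=> A B /bP[cA sA] /bQ[cB sB].
have cAB : #|A| = #|B| by rewrite cA cB.
case: aG aH => _ leG _ [_ leH _].
have := extremal_block leG cA sA; have := extremal_block leH cB sB.
case: (odd D) => [[v [? ? ?]] [u [? ? ?]]|nB nA].
  exact: (@set_iso_centre _ _ _ _ u v).
exact: (@set_iso_uniform _ _ _ _ 1).
Qed.

(** * Extremal graphs *)

(** The easy half of Tutte-Berge: a matching edge [e] meets [S] or lies in [T], so 2 is at most
    [2 * #|e :&: S| + #|e :&: T|]; summing over disjoint edges gives the bound. *)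
Lemma matching_number_le (G : sgraph) (S T : {set G}) :
    (forall x y : G, adj x y -> [|| x \in S, y \in S | (x \in T) && (y \in T)]) ->
  matching_number G <= #|S| + #|T|./2.
Proof.
move=> cov; apply/bigmax_leqP => M mM; have /andP[sM tM] := mM.
have : \sum_(e in M) 2 <= \sum_(e in M) (2 * #|e :&: S| + #|e :&: T|).
  apply: leq_sum => e /(matching_edge mM); rewrite inE.
  move=> /existsP[u /existsP[v /andP[uv /eqP->]]].
  have inS x : x \in [set u; v] -> x \in S -> 0 < #|[set u; v] :&: S|.
    by move=> xe xS; apply/card_gt0P; exists x; rewrite inE xe.
  case/or3P: (cov _ _ uv) => [uS|vS|/andP[uT vT]].
  - by have := inS u (set21 _ _) uS; clear; lia.
  - by have := inS v (set22 _ _) vS; clear; lia.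
  have /setIidPl-> : [set u; v] \subset T by rewrite subUset !sub1set uT.
  by rewrite cards2 (adj_neq uv); clear; lia.
rewrite sum_nat_const big_split /= -big_distrr /= !sum_cardI_trivIset //.
have := subset_leq_card (subsetIr (cover M) S).
have := subset_leq_card (subsetIr (cover M) T).
clear; lia.
Qed.

(** The vertex count [N] is recorded because it is the invariant that tells two extremal graphs
    apart. *)
Definition realizable D n m N : Prop :=
  exists2 G : sgraph, admissible D n G & #|edges G| = m /\ #|G| = N.

Lemma realizable_degree (D n m : nat) (G : sgraph) (S T : {set G}) :
    (forall x : G, 0 < degree x <= D) -> \sum_(x : G) degree x = 2 * m ->
    (forall x y : G, adj x y -> [|| x \in S, y \in S | (x \in T) && (y \in T)]) ->
    #|S| + #|T|./2 <= n ->
  realizable D n m #|G|.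
Proof.
move=> dG sG cov le; exists G.
  split; last exact: leq_trans (matching_number_le cov) le.
    by move=> x; case/andP: (dG x) => /card_gt0P[y]; rewrite inE => xy _; exists y.
  by apply/bigmax_leqP => x _; case/andP: (dG x).
by split=> //; apply/eqP; rewrite -(eqn_pmul2l (isT : 0 < 2)) -handshake sG.
Qed.

Lemma degree_nonadj (G : sgraph) (x : G) : degree x + #|nonadj_in [set: G] x| = #|G|.
Proof.
rewrite -cardsT -(card_nonadj_in [set: G] x); congr (_ + _).
by apply: eq_card => y; rewrite !inE.
Qed.

(** * Disjoint unions *)

Section DisjointUnion.
Variables G H : sgraph.

Definition sum_adj (x y : G + H) : bool :=
  match x, y with
  | inl u, inl v => adj u v
  | inr u, inr v => adj u v
  | _, _ => false
  end.

Lemma sum_adj_sym : symmetric sum_adj.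
Proof. by case=> x [] y //=; apply: adj_sym. Qed.

Lemma sum_adj_irrefl : irreflexive sum_adj.
Proof. by case=> x /=; apply: adj_irrefl. Qed.

Definition sum_graph := SGraph sum_adj_sym sum_adj_irrefl.

Lemma degree_sum_inl (x : G) : degree (inl x : sum_graph) = degree x.
Proof.
rewrite /degree -(card_imset _ (@inl_inj G H)); apply: eq_card => -[] y.
  by rewrite mem_imset ?inE //; apply: inl_inj.
by rewrite inE; apply/esym/imsetP => -[].
Qed.

Lemma degree_sum_inr (x : H) : degree (inr x : sum_graph) = degree x.
Proof.
rewrite /degree -(card_imset _ (@inr_inj G H)); apply: eq_card => -[] y.
  by rewrite inE; apply/esym/imsetP => -[].
by rewrite mem_imset ?inE //; apply: inr_inj.
Qed.

(** Here [h] stands for [inl] or [inr]: a matching of the union restricts to a matching of each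
    summand. *)
Lemma matching_preim (K : sgraph) (h : K -> sum_graph) (M : {set {set sum_graph}}) :
    injective h -> (forall x y, adj (h x) (h y) = adj x y) -> matching M ->
  matching [set e : {set K} | h @: e \in M].
Proof.
move=> injh adjh mM; have /andP[_ /trivIsetP tM] := mM; apply/andP; split.
  apply/subsetP => e; rewrite inE => heM; have heE := matching_edge mM heM.
  have [x xe] : exists x, x \in e.
    by apply/set0Pn/eqP => e0; have := card_edge heE; rewrite e0 imset0 cards0.
  have [z xz Ez] := edgeP heE (imset_f h xe).
  have /imsetP[y ye Ey] : z \in h @: e by rewrite Ez set22.
  rewrite Ey adjh in xz; suff -> : e = [set x; y] by apply: edge_in.
  by apply: (imset_inj injh); rewrite Ez Ey imsetU !imset_set1.
apply/trivIsetP => e1 e2; rewrite !inE => m1 m2 n12.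
have n12' : h @: e1 != h @: e2 by rewrite (inj_eq (imset_inj injh)).
have := tM _ _ m1 m2 n12'; rewrite -!setI_eq0 -imsetI; last by move=> x y _ _; apply: injh.
by rewrite imset_eq0.
Qed.

Lemma matching_number_sum :
  matching_number sum_graph <= matching_number G + matching_number H.
Proof.
apply/bigmax_leqP => M mM.
have m1 := matching_preim (@inl_inj G H : injective (inl : G -> sum_graph)) (fun _ _ => erefl) mM.
have m2 := matching_preim (@inr_inj G H : injective (inr : H -> sum_graph)) (fun _ _ => erefl) mM.
apply: leq_trans (leq_add (matching_number_max m1) (matching_number_max m2)).
set M1 := [set _ | _]; set M2 := [set _ | _].
pose E1 := (fun e : {set G} => (inl : G -> sum_graph) @: e) @: M1.
pose E2 := (fun e : {set H} => (inr : H -> sum_graph) @: e) @: M2.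
apply: (@leq_trans #|E1 :|: E2|); last first.
  by apply: leq_trans (leq_card_setU _ _) _; apply: leq_add; apply: leq_imset_card.
apply: subset_leq_card; apply/subsetP => e eM.
have := matching_edge mM eM; rewrite [e \in edges _]inE.
case/existsP=> x /existsP[y /andP[xy /eqP Ee]]; rewrite in_setU.
case: x y xy Ee => x [] y //= xy Ee; apply/orP; [left|right].
  have E : (inl : G -> sum_graph) @: [set x; y] = e by rewrite imsetU !imset_set1.
  by apply/imsetP; exists [set x; y]; rewrite ?inE ?E.
have E : (inr : H -> sum_graph) @: [set x; y] = e by rewrite imsetU !imset_set1.
by apply/imsetP; exists [set x; y]; rewrite ?inE ?E.
Qed.

End DisjointUnion.

Lemma realizable_add D n1 n2 m1 m2 N1 N2 :
  realizable D n1 m1 N1 -> realizable D n2 m2 N2 ->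
  realizable D (n1 + n2) (m1 + m2) (N1 + N2).
Proof.
case=> G [iG dG nG] [eG cG] [H [iH dH nH] [eH cH]]; exists (sum_graph G H).
  split.
  - case=> x; [have [y xy] := iG x; by exists (inl y) | have [y xy] := iH x; by exists (inr y)].
  - apply/bigmax_leqP => -[] x _; rewrite ?degree_sum_inl ?degree_sum_inr; exact: degree_le.
  - by apply: leq_trans (matching_number_sum G H) _; apply: leq_add.
split; last by rewrite card_sum cG cH.
apply/eqP; rewrite -(eqn_pmul2l (isT : 0 < 2)) -handshake big_sumType /=.
rewrite (eq_bigr _ (fun x _ => degree_sum_inl H x)) (eq_bigr _ (fun x _ => degree_sum_inr G x)).
by rewrite !handshake eG eH mulnDr.
Qed.

Lemma realizable_empty D : realizable D 0 0 0.
Proof.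
pose G := @SGraph 'I_0 (fun _ _ => false) (fun _ _ => erefl) (fun _ => erefl).
rewrite -[X in realizable _ _ _ X](card_ord 0).
apply: (@realizable_degree D 0 0 G set0 set0); rewrite ?cards0 //; try by case.
by rewrite big_ord0.
Qed.

Lemma realizable_mul D k n m N :
  realizable D n m N -> realizable D (k * n) (k * m) (k * N).
Proof.
move=> r; elim: k => [|k IH]; first exact: realizable_empty.
by rewrite !mulSn; apply: realizable_add.
Qed.

(** * Building blocks of the extremal graphs *)

Section Bipartite.
Variables a b : nat.

Definition bip_adj (x y : 'I_a + 'I_b) : bool :=
  match x, y with inl _, inr _ | inr _, inl _ => true | _, _ => false end.

Lemma bip_adj_sym : symmetric bip_adj. Proof. by case=> x []. Qed.
Lemma bip_adj_irrefl : irreflexive bip_adj. Proof. by case. Qed.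
Definition bip_graph := SGraph bip_adj_sym bip_adj_irrefl.

Lemma degree_bip (x : bip_graph) : degree x = if x is inl _ then b else a.
Proof.
case: x => x.
  rewrite -[RHS]card_ord -cardsT -(card_imset _ (@inr_inj 'I_a 'I_b)); apply: eq_card => -[] y.
    by rewrite inE; apply/esym/imsetP => -[].
  by rewrite mem_imset ?inE //; apply: inr_inj.
rewrite -[RHS]card_ord -cardsT -(card_imset _ (@inl_inj 'I_a 'I_b)); apply: eq_card => -[] y.
  by rewrite mem_imset ?inE //; apply: inl_inj.
by rewrite inE; apply/esym/imsetP => -[].
Qed.

End Bipartite.

(** The side with [a] vertices meets every edge, which bounds the matching number. The cases used
    are the star [a = 1] and [a = 2]. *)
Lemma realizable_bip a D : 0 < a <= D -> realizable D a (a * D) (a + D).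
Proof.
move=> /andP[a0 aD].
have -> : a + D = #|bip_graph a D| by rewrite card_sum !card_ord.
apply: (@realizable_degree _ _ _ (bip_graph a D) [set inl x | x : 'I_a] set0).
- by move=> x; rewrite degree_bip; case: x => _; rewrite ?a0 ?leqnn ?(leq_trans a0).
- rewrite big_sumType /= (eq_bigr (fun _ => D)); last by move=> x _; rewrite degree_bip.
  rewrite [X in _ + X](eq_bigr (fun _ => a)); last by move=> x _; rewrite degree_bip.
  by rewrite !sum_nat_const !card_ord; clear; lia.
- by case=> x [] y //= _; rewrite imset_f ?orbT.
by rewrite card_imset ?card_ord ?cards0 ?addn0 //; apply: inl_inj.
Qed.

Lemma realizable_regular D k m (G : sgraph) : 0 < D -> #|G| = k.*2.+1 ->
    (forall x : G, degree x = D) -> k.*2.+1 * D = 2 * m ->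
  realizable D k m #|G|.
Proof.
move=> D0 cG dG E; apply: (@realizable_degree _ _ _ _ set0 [set: G]).
- by move=> x; rewrite dG D0 leqnn.
- by rewrite (eq_bigr _ (fun x _ => dG x)) sum_nat_const cG.
- by move=> x y _; rewrite !inE.
by rewrite cards0 cardsT cG; clear; lia.
Qed.

Section Complete.
Variable N : nat.
Definition complete_adj (x y : 'I_N) := x != y.
Lemma complete_adj_sym : symmetric complete_adj.
Proof. by move=> x y; rewrite /complete_adj eq_sym. Qed.
Lemma complete_adj_irrefl : irreflexive complete_adj.
Proof. by move=> x; rewrite /complete_adj eqxx. Qed.
Definition complete_graph := SGraph complete_adj_sym complete_adj_irrefl.

Lemma degree_complete (x : complete_graph) : degree x = N.-1.
Proof.
have := degree_nonadj x.
have -> : nonadj_in [set: complete_graph] x = [set x].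
  by apply/setP => y; rewrite !inE /= negbK eq_sym.
by rewrite cards1 card_ord; clear; lia.
Qed.
End Complete.

Section CycleComplement.
Variable N : nat.
(** The complement of the cycle formed by [ordS]. For even D and [N = D + 3] it is D-regular of odd
    order, and replaces a block together with a star. *)
Definition co_cycle_adj (x y : 'I_N) := [&& x != y, ordS x != y & ordS y != x].
Lemma co_cycle_adj_sym : symmetric co_cycle_adj.
Proof. by move=> x y; rewrite /co_cycle_adj eq_sym [X in _ && X]andbC. Qed.
Lemma co_cycle_adj_irrefl : irreflexive co_cycle_adj.
Proof. by move=> x; rewrite /co_cycle_adj eqxx. Qed.
Definition co_cycle_graph := SGraph co_cycle_adj_sym co_cycle_adj_irrefl.

Lemma degree_co_cycle (x : co_cycle_graph) : 2 < N -> degree x = N - 3.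
Proof.
move=> N2; have := degree_nonadj x.
have -> : nonadj_in [set: co_cycle_graph] x = x |: [set ordS x; ord_pred x].
  apply/setP => y; rewrite !inE /= /co_cycle_adj !negb_and !negbK.
  rewrite eq_sym [ordS x == y]eq_sym; congr [|| _, _ | _].
  by rewrite -(inj_eq (@ord_pred_inj N)) ordSK.
have lx := ltn_ord x.
have vS : val (ordS x) = if x.+1 == N then 0 else x.+1.
  rewrite /=; case: eqP => [->|ne]; first by rewrite modnn.
  by rewrite modn_small //; move: ne lx; clear; lia.
have vP : val (ord_pred x) = if val x == 0 then N.-1 else x.-1.
  rewrite /=; case: eqP => [->|ne]; first by rewrite add0n modn_small //; move: N2; clear; lia.
  have -> : (x + N).-1 = x.-1 + N by move: ne; clear; lia.
  by rewrite modnDr modn_small //; move: lx; clear; lia.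
have -> : #|x |: [set ordS x; ord_pred x]| = 3.
  rewrite cardsU1 cards2 !inE negb_or -!val_eqE.
  move: (val (ordS x)) (val (ord_pred x)) vS vP lx N2; rewrite /=.
  move: (nat_of_ord x) => i s p; clear.
  by case: (i.+1 =P N) => e1 ->; case: (i =P 0) => e2 ->; lia.
by rewrite card_ord; clear; lia.
Qed.
End CycleComplement.

(* With c = h + 1, the complement of this graph on 2c + 1 vertices is the matching
   {(i, false), (i, true)} plus an edge joining None to (0, true). *)
Section NearRegular.
Variable h : nat.
Let V := option ('I_h.+1 * bool).
Definition near_base : V := Some (ord0, true).
Definition near_adj (x y : V) : bool :=
  match x, y with
  | Some p, Some q => p.1 != q.1
  | None, Some _ => y != near_base
  | Some _, None => x != near_base
  | None, None => false
  end.
Lemma near_adj_sym : symmetric near_adj.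
Proof. by case=> [p|] [q|] //=; rewrite eq_sym. Qed.
Lemma near_adj_irrefl : irreflexive near_adj.
Proof. by case=> [p|] //=; rewrite eqxx. Qed.
Definition near_graph := SGraph near_adj_sym near_adj_irrefl.

Lemma card_near : #|near_graph| = h.+1.*2.+1.
Proof. by rewrite card_option card_prod card_ord card_bool muln2. Qed.

Lemma degree_near (x : near_graph) : degree x = h.*2.+1 - (x == near_base).
Proof.
have := degree_nonadj x; rewrite card_near.
suff -> : #|nonadj_in [set: near_graph] x| = 2 + (x == near_base).
  by case: (x == _); clear; lia.
case: x => [[i b]|].
  have [[-> ->]|nb] := altP (Some (i, b) =P near_base).
    have -> : nonadj_in [set: near_graph] near_base =
        None |: [set Some (ord0, false); Some (ord0, true)].
      apply/setP => -[[j d]|]; rewrite !inE //= negbK eq_sym.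
      by case: eqP => [->|ne]; [case: d; rewrite eqxx ?orbT|apply/esym/norP; split; apply/eqP => -[]].
    by rewrite cardsU1 cards2 !inE.
  have -> : nonadj_in [set: near_graph] (Some (i, b)) = [set Some (i, b); Some (i, ~~ b)].
    apply/setP => -[[j d]|]; rewrite !inE /= ?negbK.
      rewrite eq_sym; case: eqP => [->|ne]; last by apply/esym/norP; split; apply/eqP => -[].
      by case: b d {nb} => [] []; rewrite eqxx ?orbT.
    by rewrite (negbTE nb).
  rewrite cards2; case: eqP => // -[]; by case: b {nb}.
have -> : nonadj_in [set: near_graph] None = [set None; near_base].
  by apply/setP => -[p|]; rewrite !inE //= negbK.
by rewrite cards2.
Qed.
End NearRegular.

(* The centre of the attached star is inr None; its b + 1 edges include one to w. *)
Section PendantStar.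
Variables (G : sgraph) (w : G) (b : nat).
Definition pendant_adj (x y : G + option 'I_b) : bool :=
  match x, y with
  | inl u, inl v => adj u v
  | inl u, inr None | inr None, inl u => u == w
  | inr None, inr (Some _) | inr (Some _), inr None => true
  | _, _ => false
  end.
Lemma pendant_adj_sym : symmetric pendant_adj.
Proof. by case=> [x|[i|]] [y|[j|]] //=; apply: adj_sym. Qed.
Lemma pendant_adj_irrefl : irreflexive pendant_adj.
Proof. by case=> [x|[i|]] //=; apply: adj_irrefl. Qed.
Definition pendant_graph := SGraph pendant_adj_sym pendant_adj_irrefl.

Lemma degree_pendant (x : pendant_graph) : degree x =
  match x with inl u => degree u + (u == w) | inr None => b.+1 | inr (Some _) => 1 end.
Proof.
case: x => [u|[i|]].
- have -> : degree u = #|(inl : G -> pendant_graph) @: [set v | adj u v]|.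
    by rewrite card_imset //; apply: inl_inj.
  rewrite /degree; case: eqP => [E|ne].
    have -> : [set y : pendant_graph | adj (inl u : pendant_graph) y] = (inr None) |: (inl @: [set v | adj u v]).
      apply/setP => -[v|[j|]]; rewrite !inE /=.
      - by rewrite mem_imset ?inE //; apply: inl_inj.
      - by apply/esym/imsetP => -[].
      by rewrite E eqxx.
    by rewrite cardsU1 addnC; congr (_ + _); case: imsetP => // -[].
  rewrite addn0; apply: eq_card => -[v|[j|]]; rewrite !inE /=.
  - by rewrite mem_imset ?inE //; apply: inl_inj.
  - by apply/esym/imsetP => -[].
  by case: eqP => // _; apply/esym/imsetP => -[].
- by rewrite -(cards1 (inr None : pendant_graph)); apply: eq_card => -[v|[j|]]; rewrite !inE.
rewrite /degree; have -> : [set y : pendant_graph | adj (inr None : pendant_graph) y] = inl w |: [set inr (Some i) | i : 'I_b].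
  apply/setP => -[v|[j|]]; rewrite !inE /=.
  - by rewrite -[LHS]orbF; congr (_ || _); apply/esym/imsetP => -[].
  - by rewrite imset_f.
  by apply/esym/imsetP => -[].
rewrite cardsU1 card_imset; last by move=> i j [].
by rewrite card_ord; case: imsetP => // -[].
Qed.
End PendantStar.

(** The near-regular graph has a single vertex of degree D - 1, [near_base]. This vertex can take
    one edge of a star, which saves one vertex compared with a disjoint star. *)
Lemma realizable_near D h : D = h.*2.+1 -> 0 < h ->
  realizable D h.+1 (h.+1 * D + h) h.+1.*2.+1 /\
  realizable D h.+2 (h.+2 * D + h) (h.+1.*2.+1 + D).
Proof.
move=> ED h0; have dN := @degree_near h.
have sN : \sum_(x : near_graph h) degree x = 2 * (h.+1 * D + h).
  rewrite (bigD1 (near_base h)) //= dN eqxx.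
  rewrite (eq_bigr (fun _ => D)); last by move=> x /negbTE ne; rewrite dN ne subn0 ED.
  by rewrite sum_nat_const cardC1 card_near; subst; clear; lia.
split.
  rewrite -card_near; apply: (@realizable_degree _ _ _ _ set0 [set: near_graph h]) => //.
  - by move=> x; rewrite dN; case: (_ == _); subst D; move: h0; clear; lia.
  - by move=> x y _; rewrite !inE.
  by rewrite cards0 cardsT card_near; clear; lia.
(* The centre gets [h.*2], that is D - 1, leaves; its remaining edge goes to [near_base], and both
   reach degree D. *)
pose H := pendant_graph (near_base h : near_graph h) h.*2.
have -> : h.+1.*2.+1 + D = #|H|.
  by rewrite card_sum card_near card_option card_ord ED.
have dH u : degree (inl u : H) = D.
  by rewrite degree_pendant dN; case: (_ == _); subst D; move: h0; clear; lia.
apply: (@realizable_degree _ _ _ H [set inr None] [set inl x | x : near_graph h]).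
- case=> [u|[i|]]; first by rewrite dH; subst D; clear; lia.
    by rewrite degree_pendant; subst D; clear; lia.
  by rewrite degree_pendant; subst D; clear; lia.
- rewrite big_sumType /= (eq_bigr _ (fun u _ => dH u)) sum_nat_const card_near.
  rewrite (bigD1 None) //= degree_pendant.
  rewrite (eq_bigr (fun _ => 1)); last by case=> [i|] // _; rewrite degree_pendant.
  by rewrite sum_nat_const cardC1 card_option card_ord; subst D; clear; lia.
- by case=> [x|[i|]] [y|[j|]] //= _; rewrite !inE ?orbT ?imset_f ?eqxx ?orbT.
rewrite cards1 card_imset; last exact: inl_inj.
by rewrite card_near; clear; lia.
Qed.

Lemma realizable_block D : 2 <= D ->
  realizable D (uphalf D) (uphalf D * D + D./2) (uphalf D).*2.+1.
Proof.
move=> hD; have := odd_double_half D; have := uphalf_half D.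
case: (odd D) => /= -> ED; last first.
  have -> : (0 + D./2).*2.+1 = #|complete_graph D.+1| by rewrite card_ord; move: ED; clear; lia.
  apply: realizable_regular.
  - by move: hD; clear; lia.
  - by rewrite card_ord; move: ED; clear; lia.
  - by move=> x; rewrite degree_complete.
  by move: ED; move: (D./2) => f <-; clear; lia.
have [||r _] := @realizable_near D D./2; [by move: ED; clear; lia|by move: hD; clear; lia|].
by rewrite add1n.
Qed.

(* One more unit of matching number than in realizable_block, but fewer new vertices
   than a disjoint star K_(1,D) would bring. *)
Lemma realizable_block_succ D : 2 <= D ->
  exists2 N, N < (uphalf D).*2.+1 + (1 + D) &
    realizable D (uphalf D + 1) ((uphalf D + 1) * D + D./2) N.
Proof.
move=> hD; have := odd_double_half D; have := uphalf_half D.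
case: (odd D) => /= -> ED; last first.
  exists #|co_cycle_graph D.+3|; first by rewrite card_ord; move: hD ED; clear; lia.
  apply: realizable_regular.
  - by move: hD; clear; lia.
  - by rewrite card_ord; move: ED; clear; lia.
  - by move=> x; rewrite degree_co_cycle //; clear; lia.
  by move: ED; move: (D./2) => f <-; clear; lia.
have [||_ r] := @realizable_near D D./2; [by move: ED; clear; lia|by move: hD; clear; lia|].
exists ((D./2).+1.*2.+1 + D); first by clear; lia.
by rewrite add1n addn1.
Qed.

(** * Sharpness of the bound and smaller extremal graphs *)

Lemma e3_value_mulD D q r : 2 <= D -> r < uphalf D ->
  e3_value D (q * uphalf D + r) = q * (uphalf D * D + D./2) + r * D.
Proof.
move=> hD lt; rewrite /e3_value divnMDl; last by move: hD; clear; lia.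
by rewrite divn_small //; clear; nia.
Qed.

(** The disjoint union of q blocks and r stars with D edges each. *)
Lemma realizable_e3_value D q r : 2 <= D -> r < uphalf D ->
  realizable D (q * uphalf D + r) (e3_value D (q * uphalf D + r))
    (q * (uphalf D).*2.+1 + r * (1 + D)).
Proof.
move=> hD lt; rewrite e3_value_mulD //; apply: realizable_add.
  exact/realizable_mul/realizable_block.
rewrite -[X in realizable _ X _ _]muln1 -[X in realizable _ _ (_ * X) _]mul1n.
by apply/realizable_mul/realizable_bip; move: hD; clear; lia.
Qed.

Lemma realizable_e3_value_smaller D q r : 2 <= D -> 0 < r < uphalf D ->
    2 <= q * uphalf D + r ->
  exists2 N, N < q * (uphalf D).*2.+1 + r * (1 + D) &
    realizable D (q * uphalf D + r) (e3_value D (q * uphalf D + r)) N.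
Proof.
move=> hD /andP[r0 lt] hn; rewrite e3_value_mulD //.
have star := @realizable_bip 1 D; have two := @realizable_bip 2 D.
have [r2|r1] := leqP 2 r.
  (* Two stars with 2D + 2 vertices give way to a complete bipartite graph with D + 2, with the same
     2D edges. *)
  exists (q * (uphalf D).*2.+1 + ((r - 2) * (1 + D) + (2 + D))).
    by move: r2 hD; clear; nia.
  have -> : r * D = (r - 2) * (1 * D) + 2 * D by move: r2; clear; nia.
  have -> : q * uphalf D + r = q * uphalf D + ((r - 2) * 1 + 2) by move: r2; clear; lia.
  apply: realizable_add; first exact/realizable_mul/realizable_block.
  apply: realizable_add; last by apply: two; rewrite hD.
  by apply/realizable_mul/star; move: hD; clear; lia.
have {r0 r1} Er : r = 1 by move: r0 r1; clear; lia.
(* With r = 1, [hn] rules out q = 0, so a block is available to be merged with the star. *)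
subst r; case: q hn => [|q] hn; first by move: hn; clear; lia.
have [N ltN rN] := realizable_block_succ hD.
exists (q * (uphalf D).*2.+1 + N); first by move: ltN; clear; lia.
have -> : q.+1 * uphalf D + 1 = q * uphalf D + (uphalf D + 1) by clear; lia.
have -> : q.+1 * (uphalf D * D + D./2) + 1 * D =
    q * (uphalf D * D + D./2) + ((uphalf D + 1) * D + D./2) by clear; nia.
by apply: realizable_add rN; apply/realizable_mul/realizable_block.
Qed.

(** * Extremal graphs and uniqueness *)

Lemma realizable_E3 D n N : 2 <= D -> realizable D n (e3_value D n) N ->
  exists2 G, E3 D n G & #|G| = N.
Proof.
move=> hD [G aG [eG cG]]; exists G => //; split=> //; split; first by exists G.
by move=> H aH; rewrite eG; apply: edges_le_e3_value.
Qed.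

(** The upper bound is compared with blocks and stars for the division of [n] by [uphalf D]. *)
Lemma E3_edges D n G : 2 <= D -> E3 D n G -> #|edges G| = e3_value D n.
Proof.
move=> hD [aG [_ maxG]]; apply/eqP; rewrite eqn_leq edges_le_e3_value //=.
have c0 : 0 < uphalf D by move: hD; clear; lia.
have := realizable_e3_value (n %/ uphalf D) hD (ltn_pmod n c0).
by rewrite -divn_eq => -[H aH [<- _]]; apply: maxG.
Qed.

(** [e3_value D] is strictly increasing in its second argument, so a smaller matching number could
    not carry that many edges. *)
Lemma E3_matching_number D n G : 2 <= D -> E3 D n G -> matching_number G = n.
Proof.
move=> hD eG; have [[iG dG nG] _] := eG.
have := @edges_le_e3_value D (matching_number G) G hD (And3 iG dG (leqnn _)).
rewrite (E3_edges hD eG) /e3_value => le; apply/eqP; rewrite eqn_leq nG leqNgt.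
apply/negP => lt; have := leq_div2r (uphalf D) nG.
move: le lt hD; move: (matching_number G) (D./2) (n %/ _) (matching_number G %/ _); clear.
by move=> m f a b; nia.
Qed.

Theorem theorem27 (D n : nat) (hD : 2 <= D) (hn : 2 <= n)
    (G : sgraph) (hG : E3 D n G) :
  (forall H : sgraph, E3 D n H -> isomorphic G H) <->
  uphalf D %| matching_number G.
Proof.
rewrite (E3_matching_number hD hG); split=> [uniqG|/dvdnP[q En] H hH]; last first.
  have := E3_edges hD hG; have := E3_edges hD hH; case: hG hH => aG _ [aH _].
  by rewrite En in aG aH * => eH eG; apply: extremal_isomorphic eG aH eH.
(* A nonzero remainder yields two extremal graphs with different numbers of vertices, yet uniqueness
   makes both isomorphic to [G]. *)
apply/negPn/negP => ndvd; have c0 : 0 < uphalf D by move: hD; clear; lia.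
have r0 : 0 < n %% uphalf D < uphalf D by rewrite ltn_pmod // lt0n andbT.
have /andP[_ rc] := r0.
have [] := realizable_e3_value_smaller (q := n %/ uphalf D) hD r0; rewrite -divn_eq // => N ltN.
case/(realizable_E3 hD) => H1 /uniqG[f1 /bij_eq_card c1 _] N1.
have := realizable_e3_value (n %/ uphalf D) hD rc; rewrite -divn_eq.
case/(realizable_E3 hD) => H2 /uniqG[f2 /bij_eq_card c2 _] N2.
by move: ltN; rewrite -N1 -N2 -c1 -c2 ltnn.
Qed.
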